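(* Let $(X,d)$ and $(Y,\rho)$ be metric spaces, let $A\subset X$ be a compact set, and let $f:X\to Y$ be a mapping that is continuous (as a mapping on $X$) at every point of $A$. Then $f$ is uniformly continuous on $A$ over the space $X$.
   Context: A mapping $f:X\to Y$ between metric spaces $(X,d)$ and $(Y,\rho)$ is called uniformly continuous on a set $A\subset X$ over the space $X$ if for every $\varepsilon>0$ there exists $\delta>0$ such that for all $x\in A$ and all $x'\in X$ with $d(x,x')<\delta$ one has $\rho(f(x),f(x'))<\varepsilon$. Continuity of $f$ on $A$ means here that at each point $y\in A$, for every $\varepsilon>0$ there is $\delta>0$ such that $\rho(f(y),f(y'))<\varepsilon$ for all $y'\in X$ (not merely $y'\in A$) with $d(y,y')<\delta$. *)

(* Defs.v *)
From HB Require Import structures.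
From mathcomp Require Import all_boot all_order all_algebra.
From mathcomp Require Import all_classical all_reals all_analysis.
Set Implicit Arguments.
Unset Strict Implicit.
Unset Printing Implicit Defensive.
Import Order.TTheory GRing.Theory Num.Theory.
Local Open Scope classical_set_scope.
Local Open Scope ring_scope.

(* Only [x] is confined to [A]: the second point [x'] ranges over all of [X],
   so this is stronger than uniform continuity of the restriction of [f] to
   [A]. *)
Definition unif_continuous_over (R : realType) (X Y : metricType R)
    (A : set X) (f : X -> Y) : Prop :=
  forall eps : R, 0 < eps -> exists2 delta : R, 0 < delta &
    forall x x' : X, A x -> mdist x x' < delta -> mdist (f x) (f x') < eps.

(* The filter of neighbourhoods of [y] used by [{for y, continuous f}] is that
   of the whole space [X], not its trace on a subset. *)
Lemma continuous_at_mdistP (R : realType) (X Y : metricType R)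
    (f : X -> Y) (y : X) :
  {for y, continuous f} <->
  forall eps : R, 0 < eps -> exists2 delta : R, 0 < delta &
    forall y' : X, mdist y y' < delta -> mdist (f y) (f y') < eps.
Proof.
split=> [/metricType_numDomainType.cvgrPdist_lt fy eps /fy|fy].
  by move/metricType_numDomainType.nbhs_mdistP => [d d0 yd]; exists d.
apply/metricType_numDomainType.cvgrPdist_lt => eps /fy[d d0 yd].
by apply/metricType_numDomainType.nbhs_mdistP; exists d.
Qed.

(* Main.v *)
(* Compactness is used as near-covering: it suffices to find, around each point
   of [A], a neighbourhood on which all small enough [delta] work. *)
Require Import Defs.
From mathcomp Require Import all_boot all_order all_algebra.
From mathcomp Require Import all_classical all_reals all_analysis.
From mathcomp Require Import lra.
Import Order.TTheory GRing.Theory Num.Theory.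
Local Open Scope classical_set_scope.
Local Open Scope ring_scope.

(** By the triangle inequality through [f y], continuity at [y] gives one [delta] valid for every
    [x] near [y]; [compact_near_coveringP] makes it common to all of [A]. *)

Theorem theorem5p2 (R : realType) (X Y : metricType R) (A : set X)
    (f : X -> Y) (cA : compact A)
    (cf : forall y : X, A y -> {for y, continuous f}) :
  unif_continuous_over A f.
Proof.
move=> eps eps0.
pose P (d : R) (x : X) :=
  forall x', mdist x x' < d -> mdist (f x) (f x') < eps.
have locP y : A y -> \forall x \near y & d \near 0^'+, P d x.
  move=> /cf/continuous_at_mdistP/(_ (eps / 2))[|r r0 fr]; first by lra.
  (* Radii [r / 2] keep both [x] and [x'] within [r] of [y]. *)
  exists ([set x | mdist y x < r / 2], [set d | d < r / 2]).
    split => /=.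
      by apply/metricType_numDomainType.nbhs_mdistP; exists (r / 2) => //=; lra.
    by apply: nbhs_right_lt; lra.
  move=> [x d] /= [yx dr] x' xx'.
  have yx' := metric_triangle y x x'.
  have fyx : mdist (f y) (f x) < eps / 2 by apply: fr; lra.
  have fyx' : mdist (f y) (f x') < eps / 2 by apply: fr; lra.
  have := metric_triangle (f x) (f y) (f x').
  by rewrite (metric_sym (f x) (f y)); lra.
have /compact_near_coveringP/(_ R 0^'+ P _ locP) AP := cA.
(* The filter [0^'+] is proper, so some [d > 0] works for all of [A] at once. *)
have [d [d0 Pd]] := filter_ex (filterI (nbhs_right_gt 0) AP).
by exists d => // x x' Ax; apply: Pd.
Qed.
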